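(* Let $m,n\ge 1$, let $R$ be a commutative ring, let $A$ be an $mn\times m$ matrix and $B$ an $mn\times n$ matrix with entries in $R$. Then $$\det(A\star B)=\sum_{\alpha,\beta}\Phi_{\alpha,\beta}\,A_\alpha\,B_\beta,$$ where the sum is over all standard Young tableaux $\alpha$ of shape $n^m$ and all standard Young tableaux $\beta$ of the conjugate shape $m^n$, and $A\star B$, $A_\alpha$, $B_\beta$ and the matrix $\Phi$ are as defined in the context.
   Context: Amalgam. Let $\underline{a}_i\in R^m$ and $\underline{b}_i\in R^n$ denote the $i$-th rows of $A$ and $B$. Then $A\star B$ is the $mn\times mn$ matrix whose $i$-th row is the Kronecker product $\underline{a}_i\otimes\underline{b}_i$, with the convention $$(a_1,\ldots,a_m)\otimes(b_1,\ldots,b_n)=(a_1b_1,a_2b_1,\ldots,a_mb_1,\ a_1b_2,\ldots,a_mb_2,\ \ldots,\ a_1b_n,\ldots,a_mb_n).$$ Minors. For $I=\{i_1<\cdots<i_m\}\subset\{1,\ldots,mn\}$, $A_I$ is the $m\times m$ matrix with rows $\underline{a}_{i_1},\ldots,\underline{a}_{i_m}$; for an $n$-element subset $I$, $B_I$ is defined similarly from the rows of $B$. Tableaux. The shape $n^m=(n,\ldots,n)$ has $m$ rows and $n$ columns; $m^n$ has $n$ rows and $m$ columns. A tableau of a given shape with $mn$ boxes is a filling by $1,\ldots,mn$, each used once; it is standard if all rows increase from left to right and all columns increase from top to bottom. The conjugate $\gamma'$ of a tableau $\gamma$ is its transpose. Two tableaux are column-equivalent if they differ only by permuting elements within each column.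 $\mathrm{col}_i(\gamma)$ is the set of entries of the $i$-th column. For $\alpha$ standard of shape $n^m$ and $\beta$ standard of shape $m^n$ put $$A_\alpha=\prod_{i=1}^n\det A_{\mathrm{col}_i(\alpha)},\qquad B_\beta=\prod_{j=1}^m\det B_{\mathrm{col}_j(\beta)}.$$ Signs. Let $1_{n^m}$ be the tableau of shape $n^m$ with $1,\ldots,mn$ placed consecutively down the first column, then down the second, etc. For a tableau $\gamma$ of shape $n^m$, $\varepsilon(\gamma)$ is the sign of the unique permutation $\pi$ of $\{1,\ldots,mn\}$ which, applied to the entries of $1_{n^m}$, gives $\gamma$. For a tableau $\beta$ of shape $m^n$, set $\varepsilon(\beta)=\varepsilon(\beta')$, where $\beta'$ has shape $n^m$. Fayers matrix. For $\alpha$ standard of shape $n^m$ and $\beta$ standard of shape $m^n$, let $\langle\alpha,\beta\rangle=0$ if there are two distinct numbers lying in a common column of $\alpha$ and in a common column of $\beta$; otherwise there is a unique tableau $\gamma$ of shape $n^m$ such that $\gamma$ is column-equivalent to $\alpha$ and $\gamma'$ is column-equivalent to $\beta$, and $\langle\alpha,\beta\rangle=\varepsilon(\gamma)$. Let $F$ be the matrix with entries $F_{\alpha,\beta}=\langle\alpha,\beta\rangle$ (rows indexed by standard $\alpha$ of shape $n^m$, columns by standard $\beta$ of shape $m^n$). It is invertible with inverse having integer entries (a result of Fayers). Let $\mathcal{E}F\mathcal{E}$ be the matrix with entries $\varepsilon(\alpha)F_{\alpha,\beta}\,\varepsilon(\beta)$, and let $\Phi=\bigl((\mathcal{E}F\mathcal{E})^{-1}\bigr)^{T}$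 be its inverse transpose, again with rows indexed by $\alpha$ and columns by $\beta$. *)

(* Defs.v *)
From HB Require Import structures.
From mathcomp Require Import all_boot all_order all_fingroup all_algebra.

Set Implicit Arguments.
Unset Strict Implicit.
Unset Printing Implicit Defensive.

Import GRing.Theory.

Local Open Scope ring_scope.

(* All indices and tableau entries start at 0 instead of 1.  The boxes of the
   shape with m rows and n columns are numbered down the columns: (i, j) is
   box number j * m + i.  The same numbering gives the order of the
   coordinates a_i b_j in the Kronecker product of rows. *)

Fact box_subproof m n (i : 'I_m) (j : 'I_n) : (j * m + i < m * n)%N.
Proof.
rewrite [(m * n)%N]mulnC (@leq_trans (j.+1 * m)%N) //.
  by rewrite mulSn addnC ltn_add2r.
by rewrite leq_mul2r ltn_ord orbT.
Qed.

Definition box m n (i : 'I_m) (j : 'I_n) : 'I_(m * n) :=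
  Ordinal (box_subproof i j).

Fact box_row_subproof m n (k : 'I_(m * n)) : (k %% m < m)%N.
Proof. by case: m k => [[]|m k] //; rewrite ltn_mod. Qed.

Fact box_col_subproof m n (k : 'I_(m * n)) : (k %/ m < n)%N.
Proof. by case: m k => [[]|m k] //; rewrite ltn_divLR // (mulnC n). Qed.

Definition box_row m n (k : 'I_(m * n)) : 'I_m := Ordinal (box_row_subproof k).
Definition box_col m n (k : 'I_(m * n)) : 'I_n := Ordinal (box_col_subproof k).

Definition kron (R : comPzRingType) m n (a : 'rV[R]_m) (b : 'rV[R]_n) :
  'rV[R]_(m * n) := \row_k (a 0 (box_row k) * b 0 (box_col k)).

Definition amalgam (R : comPzRingType) m n
    (A : 'M[R]_(m * n, m)) (B : 'M[R]_(m * n, n)) : 'M[R]_(m * n) :=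
  \matrix_k kron (row k A) (row k B).

(* [enum_val] lists the elements of I increasingly; the default 0 is only
   taken when #|I| != r. *)
Definition rows_of (R : comPzRingType) N r (A : 'M[R]_(N, r))
    (I : {set 'I_N}) : 'M[R]_r :=
  conform_mx 0 (rowsub (fun i : 'I_#|I| => enum_val i) A).

Section Tableaux.

Variables (N r c : nat).
Implicit Types T S : 'M['I_N]_(r, c).

Definition tableau T :=
  [forall x : 'I_N, #|[set p : 'I_r * 'I_c | T p.1 p.2 == x]| == 1%N].

Definition rows_increase T :=
  [forall i : 'I_r, forall j1 : 'I_c, forall j2 : 'I_c,
    (j1 < j2)%N ==> (T i j1 < T i j2)%N].

Definition cols_increase T :=
  [forall j : 'I_c, forall i1 : 'I_r, forall i2 : 'I_r,
    (i1 < i2)%N ==> (T i1 j < T i2 j)%N].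

Definition standard T := [&& tableau T, rows_increase T & cols_increase T].

Definition colset T (j : 'I_c) : {set 'I_N} := [set T i j | i : 'I_r].

Definition col_equiv S T :=
  [forall j, exists s : 'S_r, col j T == row_perm s (col j S)].

Definition same_col T (x y : 'I_N) :=
  [exists j, (x \in colset T j) && (y \in colset T j)].

Definition minor_prod (R : comPzRingType) (A : 'M[R]_(N, r)) T : R :=
  \prod_(j < c) \det (rows_of A (colset T j)).

Definition syt := {T : 'M['I_N]_(r, c) | standard T}.

HB.instance Definition _ := SubFinite.on syt.

End Tableaux.

Fact standard_tr N r c (T : 'M['I_N]_(r, c)) : standard T -> standard T^T.
Proof.
case/and3P=> /forallP tabT /forallP rowT /forallP colT; apply/and3P; split.
- apply/forallP=> x; rewrite -(eqP (tabT x)).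
  have sw_inj : injective (fun p : 'I_r * 'I_c => (p.2, p.1)).
    by move=> [? ?] [? ?] [-> ->].
  rewrite -(card_imset _ sw_inj); apply/eqP/eq_card=> -[j i].
  rewrite inE /= mxE; apply/idP/imsetP=> [Tx | [[i' j']]].
    by exists (i, j); rewrite ?inE.
  by rewrite inE /= => Tx [-> ->].
- apply/forallP=> j; apply/forallP=> i1; apply/forallP=> i2; rewrite !mxE.
  by have /forallP/(_ i1)/forallP/(_ i2) := colT j.
- apply/forallP=> i; apply/forallP=> j1; apply/forallP=> j2; rewrite !mxE.
  by have /forallP/(_ j1)/forallP/(_ j2) := rowT i.
Qed.

Definition syt_tr N r c (T : syt N r c) : syt N c r :=
  Sub (val T)^T (standard_tr (valP T)).

Definition tab1 m n : 'M['I_(m * n)]_(m, n) := \matrix_(i, j) box i j.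

(* The value 0 is only taken when g is not a tableau. *)
Definition eps m n (g : 'M['I_(m * n)]_(m, n)) : int :=
  if [pick s : 'S_(m * n) | map_mx s (tab1 m n) == g] is Some s
  then (-1) ^+ s else 0.

(* For tableaux a and b, the last default is never reached. *)
Definition bracket m n (a : 'M['I_(m * n)]_(m, n))
    (b : 'M['I_(m * n)]_(n, m)) : int :=
  if [exists x, exists y, [&& x != y, same_col a x y & same_col b x y]] then 0
  else if [pick g : 'M['I_(m * n)]_(m, n) |
             [&& tableau g, col_equiv g a & col_equiv g^T b]] is Some g
  then eps g else 0.

Definition signed_bracket m n (a : syt (m * n) m n) (b : syt (m * n) n m) :
  int := eps (val a) * bracket (val a) (val b) * eps (val b)^T.

(* The matrix EFE as a square matrix: the columns, which correspond to the
   standard tableaux b of the conjugate shape, are numbered by the rank of the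
   transpose of b.  Its inverse has integer entries (Fayers), so [invmx] over
   int is the actual inverse. *)
Definition EFE m n : 'M[int]_#|{: syt (m * n) m n}| :=
  \matrix_(i, j) signed_bracket (enum_val i) (syt_tr (enum_val j)).

Definition Phi m n (a : syt (m * n) m n) (b : syt (m * n) n m) : int :=
  (invmx (EFE m n))^T (enum_rank a) (enum_rank (syt_tr b)).

(* Main.v *)
Require Import Defs.
From HB Require Import structures.
From mathcomp Require Import all_boot all_order all_fingroup all_algebra.
From mathcomp Require Import zify ring.

(** Expanding det (A * B) (the amalgam) along its rows gives one term for each
    pair of labellings r of the rows of A by columns of A, and c of the rows of
    B by columns of B:

      det (amalgam A B) = sum_(r, c) A^r B^c <r, c>,

    where A^r and B^c are the monomials prod_k A k (r k) and prod_k B k (c k),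
    and the pairing <r, c> is the sign of the permutation k |-> box (r k) (c k),
    or 0 if this is no permutation ([det_amalgam_expand]).  For a tableau a let
    row_of a and col_of a send an entry to its row and its column.  Both sides
    of the theorem reduce to this pairing.

    - Specialising B to the 0/1 matrix of the labelling col_of a makes the
      amalgam block diagonal up to the permutation that reads a, so A_a is eps a
      times the determinant of that amalgam.  Hence the coefficient of A^r in
      A_a is eps a * <r, col_of a>, and likewise for B
      ([minor_prod_col_expand], [minor_prod_row_expand]).
    - The bracket of a and of the transpose of d is <row_of d, col_of a>
      ([bracket_pairing]).

    Thus the theorem says that for all labellings

      <r, c> = sum_(a, d) <r, col_of a> (F^-1)_(d, a) <row_of d, c>

    ([pairing_expand]), i.e. that the pairing is recovered from its restriction
    F to standard tableaux.  Two facts are needed.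

    First, F is invertible over the integers ([EFE_unit]).  If <row_of d,
    col_of a> is nonzero and a <> d, then at the smallest entry where row_of a
    and row_of d differ, row_of d is the larger one: the entries of a above k in
    its column are smaller than k and already occupy their rows.  So F is
    unitriangular up to signs for the lexicographic order of row_of.

    Second, a Z-linear combination h of the functions c |-> <r, c> that vanishes
    on the labellings col_of a with a standard vanishes everywhere
    ([straightening]).  The reason is the Garnir relation: if X has more than m
    elements, two of them have the same label under r, and the transposition of
    these two cancels the sum of <r, c o s> over the permutations s of X in
    pairs.  At a violation of standardness between two columns of c, this
    relation expresses h c by values of h at labellings of larger weight
    sum_k k * c k.  Applied to the difference of the two sides above, as a
    function of c, this yields the identity. *)

Set Implicit Arguments.
Unset Strict Implicit.
Unset Printing Implicit Defensive.

Import Order.TTheory GRing.Theory Num.Theory.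

Local Open Scope ring_scope.

(** * Boxes and block diagonal determinants *)

Lemma box_rowK m n (i : 'I_m) (j : 'I_n) : box_row (box i j) = i.
Proof. by apply/val_inj; rewrite /= modnMDl modn_small. Qed.

Lemma box_colK m n (i : 'I_m) (j : 'I_n) : box_col (box i j) = j.
Proof.
apply/val_inj; case: m i => [[]|m] // i.
by rewrite /= divnMDl // divn_small // addn0.
Qed.

Lemma boxK m n (k : 'I_(m * n)) : box (box_row k) (box_col k) = k.
Proof. by apply/val_inj; rewrite /= -divn_eq. Qed.

Lemma box_eqE m n (i i' : 'I_m) (j j' : 'I_n) :
  (box i j == box i' j') = (i == i') && (j == j').
Proof.
apply/eqP/andP => [E | [/eqP-> /eqP->] //].
by rewrite -(box_rowK i j) -{2}(box_colK i j) E box_rowK box_colK.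
Qed.

Lemma det_reindex (R : comPzRingType) N N' (f : 'I_N -> 'I_N') (M : 'M[R]_N') :
  bijective f -> \det (\matrix_(k, l) M (f k) (f l)) = \det M.
Proof.
move=> f_bij; have: N = N' by rewrite -[LHS]card_ord (bij_eq_card f_bij) card_ord.
move=> defN'; case: _ / defN' => {N'} in f M f_bij *.
have f_inj := bij_inj f_bij; pose s := perm f_inj.
have ->: \matrix_(k, l) M (f k) (f l) = perm_mx s *m M *m (perm_mx s)^T.
  apply/matrixP=> k l; rewrite tr_perm_mx -row_permE -col_permE !mxE.
  by rewrite !permE.
by rewrite !det_mulmx det_tr det_perm mulrAC -signr_addb addbb mul1r.
Qed.

(** The blocks are indexed by the columns, which the numbering of the boxes makes
    contiguous: the first m boxes split off the first block. *)
Lemma det_block_col (R : comPzRingType) m n (X : 'I_n -> 'M[R]_m) :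
  \det (\matrix_(k, l < m * n) 
     ((box_col k == box_col l)%:R * X (box_col k) (box_row k) (box_row l)))
  = \prod_j \det (X j).
Proof.
elim: n => [|n IHn] in X *.
  rewrite big_ord0; move: (\matrix_(k, l) _); rewrite muln0 => M.
  exact: det_mx00.
pose f (k : 'I_(m + m * n)) : 'I_(m * n.+1) :=
  match split k with
  | inl i => box i ord0
  | inr k => box (box_row k) (lift ord0 (box_col k))
  end.
have f_inj : injective f.
  move=> k l; rewrite /f; case: splitP => i Ei; case: splitP => j Ej /eqP.
  - by rewrite box_eqE => /andP[/eqP E _]; apply/val_inj; rewrite /= Ei E Ej.
  - by rewrite box_eqE => /andP[].
  - by rewrite box_eqE => /andP[].
  rewrite box_eqE => /andP[/eqP Er /eqP/lift_inj Ec].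
  by apply/val_inj; rewrite /= Ei Ej -(boxK i) -(boxK j) Er Ec.
have f_bij : bijective f.
  by apply: inj_card_bij f_inj _; rewrite !card_ord mulnS.
rewrite -(det_reindex _ f_bij) big_ord_recl -IHn.
rewrite -(det_ublock _ 0); congr (\det _).
rewrite -[LHS]submxK; congr block_mx; apply/matrixP=> i j; rewrite !mxE /f.
- by rewrite !(unsplitK (inl _)) !box_colK !box_rowK eqxx mul1r.
- by rewrite !(unsplitK (inl _)) !(unsplitK (inr _)) !box_colK mul0r.
- by rewrite !(unsplitK (inl _)) !(unsplitK (inr _)) !box_colK mul0r.
by rewrite !(unsplitK (inr _)) !box_colK !box_rowK (inj_eq lift_inj).
Qed.

(** Transposing the boxes turns the rows into columns; the rows and the columns of
    the matrix are permuted alike, so the determinant does not change. *)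
Lemma det_block_row (R : comPzRingType) m n (X : 'I_m -> 'M[R]_n) :
  \det (\matrix_(k, l < m * n) 
     ((box_row k == box_row l)%:R * X (box_row k) (box_col k) (box_col l)))
  = \prod_i \det (X i).
Proof.
rewrite -det_block_col.
pose f (k : 'I_(m * n)) : 'I_(n * m) := box (box_col k) (box_row k).
have f_bij : bijective f.
  by exists (fun k => box (box_col k) (box_row k)) => k;
     rewrite /f box_rowK box_colK boxK.
rewrite -[RHS](det_reindex _ f_bij); congr (\det _); apply/matrixP=> k l.
by rewrite !mxE !box_rowK !box_colK.
Qed.

(** * The pairing of row and column labellings *)

Definition indicator_mx (R : comPzRingType) N r (f : {ffun 'I_N -> 'I_r}) :
  'M[R]_(N, r) := \matrix_(k, i) (f k == i)%:R.

(** The sign of k |-> box (r k) (c k) when this is a permutation, and 0 otherwise: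
    the coefficient of the monomial of r and c in the determinant of the
    amalgam. *)
Definition pairing m n (r : {ffun 'I_(m * n) -> 'I_m})
    (c : {ffun 'I_(m * n) -> 'I_n}) : int :=
  \det (\matrix_(k, l) (box (r k) (c k) == l)%:R).

Definition precomp N r (f : {ffun 'I_N -> 'I_r}) (s : 'S_N) :
  {ffun 'I_N -> 'I_r} := [ffun k => f (s k)].

(** In the Leibniz formula the term of a permutation s contributes to exactly one
    pair of labellings, the row and the column of the box s k. *)
Lemma det_amalgam_expand (R : comPzRingType) m n
    (A : 'M[R]_(m * n, m)) (B : 'M[R]_(m * n, n)) :
  \det (amalgam A B) =
    \sum_(r : {ffun 'I_(m * n) -> 'I_m}) \sum_(c : {ffun 'I_(m * n) -> 'I_n})
      (\prod_k A k (r k)) * (\prod_k B k (c k)) * (pairing r c)%:~R.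
Proof.
pose t r c (s : 'S_(m * n)) : R := (-1) ^+ s *
  \prod_k (A k (r k) * B k (c k) * (box (r k) (c k) == s k)%:R).
transitivity (\sum_(s : 'S_(m * n)) \sum_(r : {ffun 'I_(m * n) -> 'I_m})
    \sum_(c : {ffun 'I_(m * n) -> 'I_n}) t r c s).
  apply: eq_bigr => s _.
  pose rs := [ffun k => box_row (s k)]; pose cs := [ffun k => box_col (s k)].
  have t0 r c : (r != rs) || (c != cs) -> t r c s = 0.
    move=> rc_neq; case: (pickP [pred k | box (r k) (c k) != s k]) => [k ks | eqs].
      by rewrite /t (bigD1 k) //= (negPf ks) mulr0 mul0r mulr0.
    case/orP: rc_neq => /eqP[]; apply/ffunP=> k; have /negbFE/eqP Ek := eqs k.
      by rewrite ffunE -Ek box_rowK.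
    by rewrite ffunE -Ek box_colK.
  rewrite (bigD1 rs) // (bigD1 cs) //= [X in _ + X + _]big1 => [|c c_neq];
    last first.
    by apply: t0; rewrite c_neq orbT.
  rewrite addr0 [X in _ + X]big1 => [|r r_neq]; last first.
    by rewrite big1 // => c _; apply: t0; rewrite r_neq.
  rewrite addr0 /t; congr (_ * _); apply: eq_bigr => k _.
  by rewrite !mxE !ffunE boxK eqxx mulr1.
rewrite exchange_big /=; apply: eq_bigr => r _.
rewrite exchange_big /=; apply: eq_bigr => c _.
rewrite /pairing /determinant rmorph_sum mulr_sumr; apply: eq_bigr => s _.
rewrite /t big_split /= big_split /= mulrCA rmorphM rmorphXn rmorphN1; congr (_ * (_ * _)).
by rewrite rmorph_prod; apply: eq_bigr => k _; rewrite !mxE rmorph_nat.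
Qed.

Lemma prod_indicator (R : comPzRingType) N r (f g : {ffun 'I_N -> 'I_r}) :
  \prod_k indicator_mx R f k (g k) = (f == g)%:R.
Proof.
case: eqP => [-> | neq_fg]; first by rewrite big1 // => k _; rewrite mxE eqxx.
case: (pickP [pred k | f k != g k]) => [k fgk | eq_fg].
  by rewrite (bigD1 k) //= mxE (negPf fgk) mul0r.
by case: neq_fg; apply/ffunP=> k; apply/eqP/negbFE/eq_fg.
Qed.

Lemma det_amalgam_indr (R : comPzRingType) m n (A : 'M[R]_(m * n, m)) c :
  \det (amalgam A (indicator_mx R c)) =
    \sum_(r : {ffun 'I_(m * n) -> 'I_m})
      (\prod_k A k (r k)) * (pairing r c)%:~R :> R.
Proof.
rewrite det_amalgam_expand; apply: eq_bigr => r _.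
rewrite (bigD1 c) //= prod_indicator eqxx mulr1 [X in _ + X]big1 ?addr0 // => c' c'_neq.
by rewrite prod_indicator eq_sym (negPf c'_neq) mulr0 mul0r.
Qed.

Lemma det_amalgam_indl (R : comPzRingType) m n (B : 'M[R]_(m * n, n)) r :
  \det (amalgam (indicator_mx R r) B) =
    \sum_(c : {ffun 'I_(m * n) -> 'I_n})
      (\prod_k B k (c k)) * (pairing r c)%:~R :> R.
Proof.
rewrite det_amalgam_expand (bigD1 r) //= [X in _ + X]big1 ?addr0 => [|r' r'_neq].
  by apply: eq_bigr => c _; rewrite prod_indicator eqxx mul1r.
by apply: big1 => c _; rewrite prod_indicator eq_sym (negPf r'_neq) !mul0r.
Qed.

Lemma pairing_precomp m n (r : {ffun 'I_(m * n) -> 'I_m})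
    (c : {ffun 'I_(m * n) -> 'I_n}) (s : 'S_(m * n)) :
  pairing (precomp r s) (precomp c s) = (-1) ^+ s * pairing r c.
Proof.
rewrite /pairing -det_perm -det_mulmx -row_permE; congr (\det _).
by apply/matrixP=> k l; rewrite !mxE !ffunE.
Qed.

Lemma pairing_eq0 m n (r : {ffun 'I_(m * n) -> 'I_m})
    (c : {ffun 'I_(m * n) -> 'I_n}) k l :
  k != l -> r k = r l -> c k = c l -> pairing r c = 0.
Proof.
by move=> neq_kl rkl ckl; apply: (determinant_alternate neq_kl) => i; rewrite !mxE rkl ckl.
Qed.

Lemma pairing_perm m n (s : 'S_(m * n)) :
  pairing [ffun k => box_row (s k)] [ffun k => box_col (s k)] = (-1) ^+ s.
Proof.
rewrite -det_perm; congr (\det _).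
by apply/matrixP=> k l; rewrite !mxE !ffunE boxK.
Qed.

(** * Tableaux as permutations *)

(** The permutation pi of the definition of the sign; the default 1 is only taken
    when g is not a tableau. *)
Definition reading m n (g : 'M['I_(m * n)]_(m, n)) : 'S_(m * n) :=
  odflt 1%g [pick s : 'S_(m * n) | map_mx s (tab1 m n) == g].

Definition row_of m n (g : 'M['I_(m * n)]_(m, n)) : {ffun 'I_(m * n) -> 'I_m} :=
  [ffun k => box_row ((reading g)^-1%g k)].

Definition col_of m n (g : 'M['I_(m * n)]_(m, n)) : {ffun 'I_(m * n) -> 'I_n} :=
  [ffun k => box_col ((reading g)^-1%g k)].

Section Reading.

Variables (m n : nat) (g : 'M['I_(m * n)]_(m, n)).
Hypothesis tab_g : tableau g.

Lemma map_reading : map_mx (reading g) (tab1 m n) = g.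
Proof.
rewrite /reading; case: pickP => [s /eqP // | no_s].
have g_inj : injective (fun k => g (box_row k) (box_col k)).
  move=> k l /= Egkl.
  have /cards1P[p /setP Ep] := forallP tab_g (g (box_row k) (box_col k)).
  have := Ep (box_row k, box_col k); have := Ep (box_row l, box_col l).
  rewrite !inE /= Egkl eqxx => /esym/eqP El /esym/eqP.
  rewrite -El => /eqP; rewrite xpair_eqE => /andP[/eqP Er /eqP Ec].
  by rewrite -(boxK k) -(boxK l) Er Ec.
have /eqP[] := no_s (perm g_inj).
by apply/matrixP=> i j; rewrite !mxE permE box_rowK box_colK.
Qed.

Lemma reading_box i j : reading g (box i j) = g i j.
Proof. by rewrite -[in RHS]map_reading !mxE. Qed.

Lemma row_ofE i j : row_of g (g i j) = i.
Proof. by rewrite ffunE -reading_box permK box_rowK. Qed.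

Lemma col_ofE i j : col_of g (g i j) = j.
Proof. by rewrite ffunE -reading_box permK box_colK. Qed.

Lemma entryK k : g (row_of g k) (col_of g k) = k.
Proof. by rewrite -reading_box !ffunE boxK permKV. Qed.

Lemma epsE : eps g = (-1) ^+ reading g.
Proof.
rewrite /eps /reading; case: pickP => // no_s.
by have := no_s (reading g); rewrite map_reading eqxx.
Qed.

Lemma pairing_tableau : pairing (row_of g) (col_of g) = eps g.
Proof. by rewrite pairing_perm odd_permV epsE. Qed.

Lemma mem_colset j k : (k \in colset g j) = (col_of g k == j).
Proof.
apply/imsetP/eqP => [[i _ ->] | <-]; first by rewrite col_ofE.
by exists (row_of g k); rewrite // entryK.
Qed.

(** Once the rows are permuted by the reading of g, the row of box (i, j) is row
    g i j of A placed in the block of column j. *)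
Lemma det_amalgam_col (R : comPzRingType) (A : 'M[R]_(m * n, m)) :
  \det (amalgam A (indicator_mx R (col_of g))) =
    (eps g)%:~R * \prod_j \det (rowsub (g^~ j) A).
Proof.
rewrite -det_block_col epsE rmorphXn rmorphN1 -det_perm.
have ->: perm_mx (reading g) = (perm_mx (reading g)^-1)^T :> 'M[R]_(m * n).
  by rewrite tr_perm_mx invgK.
rewrite det_tr -det_mulmx -row_permE; congr (\det _).
apply/matrixP=> k l; rewrite !mxE !ffunE mulrC -reading_box boxK permKV.
by congr (_ * _).
Qed.

Lemma det_amalgam_row (R : comPzRingType) (B : 'M[R]_(m * n, n)) :
  \det (amalgam (indicator_mx R (row_of g)) B) =
    (eps g)%:~R * \prod_i \det (rowsub (g i) B).
Proof.
rewrite -det_block_row epsE rmorphXn rmorphN1 -det_perm.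
have ->: perm_mx (reading g) = (perm_mx (reading g)^-1)^T :> 'M[R]_(m * n).
  by rewrite tr_perm_mx invgK.
rewrite det_tr -det_mulmx -row_permE; congr (\det _).
apply/matrixP=> k l; rewrite !mxE !ffunE -reading_box boxK permKV.
by congr (_ * _).
Qed.

End Reading.

(** * Minors and brackets of standard tableaux *)

Lemma sorted_enum_ord N (A : {pred 'I_N}) :
  sorted (fun k l : 'I_N => (k < l)%N) (enum A).
Proof.
have lt_tr : transitive (fun k l : 'I_N => (k < l)%N).
  by move=> l k p; apply: ltn_trans.
rewrite /enum_mem (sorted_filter lt_tr) // -enumT.
by have := iota_ltn_sorted 0 N; rewrite -val_enum_ord sorted_map.
Qed.

(** [rows_of] lists the rows of A in increasing order, so the signs of the minors
    are those of the tableau because standard tableaux increase along their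
    columns and, for the transpose, along their rows. *)
Lemma rows_of_increasing (R : comPzRingType) N r (A : 'M[R]_(N, r))
    (u : 'I_r -> 'I_N) :
  (forall i1 i2 : 'I_r, (i1 < i2)%N -> (u i1 < u i2)%N) ->
  rows_of A [set u i | i : 'I_r] = rowsub u A.
Proof.
move=> u_incr; set S := [set u i | i : 'I_r].
have lt_tr : transitive (fun k l : 'I_N => (k < l)%N).
  by move=> l k p; apply: ltn_trans.
have enumS : enum S = map u (enum 'I_r).
  apply: (irr_sorted_eq lt_tr) => [k||| k].
  - exact: ltnn.
  - exact: sorted_enum_ord.
  - exact: homo_sorted (@sorted_enum_ord _ _).
  rewrite mem_enum; apply/imsetP/mapP => -[i _ ->]; exists i => //.
  by rewrite mem_enum.
have cardS : #|S| = r by rewrite cardE enumS size_map size_enum_ord.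
rewrite /rows_of /conform_mx; case: eqP => [e1|]; last by rewrite cardS.
case: eqP => // e2; apply/matrixP=> i j; rewrite castmxE !mxE.
rewrite [cast_ord _ j](val_inj (_ : val _ = val j)) //.
congr (A _ _); rewrite (enum_val_nth (u i)) enumS /= (nth_map i) ?size_enum_ord //.
by rewrite nth_ord_enum.
Qed.

(** The functions fr and fc locate an entry of S; stating the lemma for them makes
    it apply both to a tableau and to its transpose. *)
Lemma col_equivE N r c (S T : 'M['I_N]_(r, c)) (fr : 'I_N -> 'I_r)
    (fc : 'I_N -> 'I_c) :
    (forall k, S (fr k) (fc k) = k) -> (forall i j, fc (S i j) = j) ->
    (forall j, injective (T^~ j)) ->
  col_equiv S T = [forall i, forall j, fc (T i j) == j].
Proof.
move=> frcK fcE T_inj; apply/forallP/forallP => [ST i | fcT j].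
  apply/forallP=> j; have /existsP[s /eqP/matrixP/(_ i 0)] := ST j.
  by rewrite !mxE => ->; rewrite fcE.
have TE i : S (fr (T i j)) j = T i j.
  by have /forallP/(_ j)/eqP E := fcT i; rewrite -{2}E frcK.
have s_inj : injective (fun i => fr (T i j)).
  by move=> i1 i2 /= E; apply: (T_inj j); rewrite -TE E TE.
apply/existsP; exists (perm s_inj); apply/eqP/matrixP=> i k.
by rewrite !mxE permE TE.
Qed.

Section Standard.

Variables m n : nat.
Implicit Types a d g : 'M['I_(m * n)]_(m, n).

Lemma standard_tableau a : standard a -> tableau a.
Proof. by case/and3P. Qed.

Lemma standard_row a i (j1 j2 : 'I_n) : standard a -> (j1 < j2)%N -> (a i j1 < a i j2)%N.
Proof.
by case/and3P=> _ /forallP/(_ i)/forallP/(_ j1)/forallP/(_ j2)/implyP + _; apply.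
Qed.

Lemma standard_col a (i1 i2 : 'I_m) j : standard a -> (i1 < i2)%N -> (a i1 j < a i2 j)%N.
Proof.
by case/and3P=> _ _ /forallP/(_ j)/forallP/(_ i1)/forallP/(_ i2)/implyP; apply.
Qed.

(** The factor eps a is its own inverse, so it can move to the other side of
    [det_amalgam_col]. *)
Lemma minor_prod_col (R : comPzRingType) (A : 'M[R]_(m * n, m)) a :
  standard a ->
  (minor_prod A a) = (eps a)%:~R * \det (amalgam A (indicator_mx R (col_of a))).
Proof.
move=> std_a; have tab_a := standard_tableau std_a.
rewrite det_amalgam_col // mulrA -rmorphM epsE // -signr_addb addbb mul1r.
apply: eq_bigr => j _; congr (\det _).
by apply: (@rows_of_increasing _ _ _ _ (a^~ j)) => i1 i2; apply: standard_col.
Qed.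

Lemma minor_prod_row (R : comPzRingType) (B : 'M[R]_(m * n, n)) a :
  standard a ->
  (minor_prod B a^T) = (eps a)%:~R * \det (amalgam (indicator_mx R (row_of a)) B).
Proof.
move=> std_a; have tab_a := standard_tableau std_a.
rewrite det_amalgam_row // mulrA -rmorphM epsE // -signr_addb addbb mul1r.
apply: eq_bigr => i _; congr (\det _).
rewrite -rows_of_increasing => [|j1 j2]; last exact: standard_row.
by congr (rows_of _ _); apply: eq_imset => j; rewrite mxE.
Qed.

Lemma same_colE a k l : tableau a -> same_col a k l = (col_of a k == col_of a l).
Proof.
move=> tab_a; apply/existsP/eqP => [[j] | E].
  by rewrite !mem_colset // => /andP[/eqP-> /eqP->].
by exists (col_of a k); rewrite !mem_colset // E eqxx.
Qed.

Lemma same_col_trE d k l :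
  tableau d -> same_col d^T k l = (row_of d k == row_of d l).
Proof.
move=> tab_d.
have mem_rowset i p : (p \in colset d^T i) = (row_of d p == i).
  apply/imsetP/eqP => [[j _ ->] | <-]; first by rewrite mxE row_ofE.
  by exists (col_of d p); rewrite // mxE entryK.
apply/existsP/eqP => [[i] | E]; first by rewrite !mem_rowset => /andP[/eqP-> /eqP->].
by exists (row_of d k); rewrite !mem_rowset E eqxx.
Qed.

Lemma tableau_map (s : 'S_(m * n)) : tableau (map_mx s (tab1 m n)).
Proof.
apply/forallP=> x; apply/cards1P.
exists (box_row (s^-1%g x), box_col (s^-1%g x)); apply/setP=> -[i j].
rewrite !inE /= !mxE xpair_eqE; apply/eqP/andP => [<- | [/eqP-> /eqP->]].
  by rewrite permK box_rowK box_colK !eqxx.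
by rewrite boxK permKV.
Qed.

Lemma col_equiv_col_of g a : tableau g -> tableau a ->
  col_equiv g a = (col_of g == col_of a).
Proof.
move=> tab_g tab_a.
rewrite (col_equivE (entryK tab_g) (col_ofE tab_g)) => [|j i1 i2 E]; last first.
  by rewrite -(row_ofE tab_a i1 j) E row_ofE.
apply/forallP/eqP => [E | -> i].
  apply/ffunP=> k; rewrite -{1}(entryK tab_a k); apply/eqP.
  by have /forallP := E (row_of a k); apply.
by apply/forallP=> j; rewrite col_ofE.
Qed.

Lemma col_equiv_row_of g d : tableau g -> tableau d ->
  col_equiv g^T d^T = (row_of g == row_of d).
Proof.
move=> tab_g tab_d; rewrite (@col_equivE _ _ _ _ _ (col_of g) (row_of g)).
- apply/forallP/eqP => [E | -> j].
    apply/ffunP=> k; rewrite -{1}(entryK tab_d k); apply/eqP.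
    by have /forallP/(_ (row_of d k)) := E (col_of d k); rewrite mxE.
  by apply/forallP=> i; rewrite mxE row_ofE.
- by move=> k; rewrite mxE entryK.
- by move=> i j; rewrite mxE row_ofE.
by move=> i j1 j2; rewrite !mxE => E; rewrite -(col_ofE tab_d i j1) E col_ofE.
Qed.

(** The tableau gamma of the definition is the inverse of k |-> box (row_of d k)
    (col_of a k), which is injective exactly when no two numbers share a column
    of a and a row of d. *)
Lemma bracket_pairing a d : tableau a -> tableau d ->
  bracket a d^T = pairing (row_of d) (col_of a).
Proof.
move=> tab_a tab_d; rewrite /bracket.
case: ifPn => [/existsP[x /existsP[y /and3P[neq_xy]]] | no_xy].
  rewrite same_colE // same_col_trE // => /eqP Ec /eqP Er.
  by rewrite (pairing_eq0 neq_xy).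
have f_inj : injective (fun k => box (row_of d k) (col_of a k)).
  move=> x y /eqP; rewrite box_eqE => /andP[Er Ec].
  apply: contraNeq no_xy => neq_xy; apply/existsP; exists x; apply/existsP; exists y.
  by rewrite neq_xy same_colE // same_col_trE // Er Ec.
pose g0 := map_mx (perm f_inj)^-1%g (tab1 m n).
have tab_g0 : tableau g0 by apply: tableau_map.
have g0E i j : g0 i j = (perm f_inj)^-1%g (box i j) by rewrite !mxE.
have g0K k : g0 (row_of d k) (col_of a k) = k.
  by rewrite g0E -(permE f_inj) permK.
case: pickP => [g /and3P[tab_g] | /(_ g0)].
  rewrite col_equiv_col_of // col_equiv_row_of // => /eqP <- /eqP <-.
  by rewrite pairing_tableau.
rewrite tab_g0 col_equiv_col_of // col_equiv_row_of //=.
case/negP; apply/andP; split; apply/eqP/ffunP=> k.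
  by rewrite -{1}(g0K k) col_ofE.
by rewrite -{1}(g0K k) row_ofE.
Qed.

End Standard.

(** * Invertibility over the integers *)

(** A matrix that is triangular for the lexicographic order of the sequences h i.
    If all entries M i (s i) are nonzero, then the first position k where some
    h i and h (s i) differ would have h i k <= h (s i) k for all i, although the
    two sides have the same sum over i.  So only the identity survives in the
    Leibniz formula. *)
Lemma det_first_difference (R : comPzRingType) d N (M : 'M[R]_d)
    (h : 'I_d -> 'I_N -> nat) :
    (forall i j, M i j != 0 -> forall k : 'I_N,
       (forall l : 'I_N, (l < k)%N -> h i l = h j l) -> (h i k <= h j k)%N) ->
    (forall i j, h i =1 h j -> i = j) ->
  \det M = \prod_i M i i.
Proof.
move=> M_neq0 h_inj; rewrite /determinant (bigD1 1%g) //= odd_perm1 mul1r.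
under eq_bigr do rewrite perm1.
rewrite [X in _ + X]big1 ?addr0 // => s s_neq1.
case: (pickP [pred i | M i (s i) == 0]) => [i /eqP Mis0 | M_s].
  by rewrite (bigD1 i) //= Mis0 mul0r mulr0.
have h_s (w : nat) : forall k : 'I_N, (k < w)%N -> forall i, h i k = h (s i) k.
  elim: w => [//|w IHw] k lt_kw i.
  have le_h j : (h j k <= h (s j) k ?= iff (h j k == h (s j) k))%N.
    split=> //; apply: M_neq0 => [|l lt_lk]; first exact: negbT (M_s j).
    by rewrite IHw // (leq_trans lt_lk).
  have [_] := leqif_sum (P := predT) (fun j _ => le_h j).
  rewrite -(reindex_inj (@perm_inj _ s) (P := predT) (F := fun j => h j k)).
  by rewrite eqxx => /esym/forall_inP/(_ i isT)/eqP.
case/eqP: s_neq1; apply/permP=> i; rewrite perm1; apply: esym.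
by apply: h_inj => k; apply: (h_s k.+1).
Qed.

Section Unimodular.

Variables m n : nat.
Implicit Types a d : 'M['I_(m * n)]_(m, n).

(** If k were in a higher row in d than in a, the entry x of a in that row and in
    the column of k would be smaller than k, hence in the same row of d as k:
    x and k would collide. *)
Lemma pairing_first_difference a d (k : 'I_(m * n)) : standard a -> standard d ->
    pairing (row_of d) (col_of a) != 0 ->
    (forall l : 'I_(m * n), (l < k)%N -> row_of a l = row_of d l) ->
  (row_of a k <= row_of d k)%N.
Proof.
move=> std_a std_d nz_ad eq_lt; rewrite leqNgt; apply: contra nz_ad => lt_da.
have tab_a := standard_tableau std_a.
pose x := a (row_of d k) (col_of a k).
have lt_xk: (x < k)%N by rewrite -(entryK tab_a k) standard_col.
have neq_xk: x != k by rewrite -val_eqE /= ltn_eqF.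
by rewrite (pairing_eq0 neq_xk) // ?col_ofE // -eq_lt // row_ofE.
Qed.

(** In a standard tableau the entries of each row are sorted, so the rows as sets
    determine the tableau. *)
Lemma row_of_inj a d : standard a -> standard d ->
  row_of a = row_of d -> a = d.
Proof.
move=> std_a std_d eq_row.
have col_le b e (k : 'I_(m * n)) : standard b -> standard e ->
    row_of b = row_of e ->
    (forall l : 'I_(m * n), (l < k)%N -> col_of b l = col_of e l) ->
    (col_of b k <= col_of e k)%N.
  move=> std_b std_e eq_be eq_lt; rewrite leqNgt; apply/negP=> lt_eb.
  have [tab_b tab_e] := (standard_tableau std_b, standard_tableau std_e).
  pose x := b (row_of b k) (col_of e k).
  have lt_xk: (x < k)%N by rewrite -(entryK tab_b k) standard_row.
  have: x = k.
    rewrite -(entryK tab_e x) -(entryK tab_e k) -eq_lt // -eq_be.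
    by rewrite row_ofE // col_ofE.
  by move/(congr1 val)/eqP; rewrite ltn_eqF.
have eq_col (w : nat) (k : 'I_(m * n)) : (k < w)%N -> col_of a k = col_of d k.
  elim: w k => [//|w IHw] k lt_kw; apply/val_inj/eqP; rewrite eqn_leq.
  by rewrite !col_le // => l lt_lk; rewrite IHw // (leq_trans lt_lk).
have [tab_a tab_d] := (standard_tableau std_a, standard_tableau std_d).
apply/matrixP=> i j; rewrite -[LHS](entryK tab_d) -eq_row.
by rewrite -(eq_col (a i j).+1) // row_ofE // col_ofE.
Qed.

Lemma eps_sq a : tableau a -> eps a * eps a = 1.
Proof. by move=> tab_a; rewrite epsE // -signr_addb addbb. Qed.

Lemma signed_bracketE (a d : syt (m * n) m n) :
  signed_bracket a (syt_tr d) =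
    eps (val a) * pairing (row_of (val d)) (col_of (val a)) * eps (val d).
Proof.
rewrite /signed_bracket [val (syt_tr d)]/= trmxK bracket_pairing //.
  exact: standard_tableau (valP a).
exact: standard_tableau (valP d).
Qed.

Lemma EFE_unit : EFE m n \in unitmx.
Proof.
rewrite unitmxE.
rewrite (@det_first_difference _ _ _ _ (fun i k => row_of (val (enum_val i)) k)).
- rewrite rpred_prod // => i _; rewrite mxE signed_bracketE.
  have tab_i := standard_tableau (valP (enum_val i)).
  by rewrite pairing_tableau // eps_sq // mul1r epsE // unitrX // unitrN1.
- move=> i j; rewrite mxE signed_bracketE => nz_ij k eq_lt.
  apply: pairing_first_difference (valP _) (valP _) _ _ => [|l lt_lk].
    by apply: contraNneq nz_ij => ->; rewrite mulr0 mul0r.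
  by apply/val_inj/eq_lt.
move=> i j eq_ij; apply/enum_val_inj/val_inj/(row_of_inj (valP _) (valP _)).
by apply/ffunP=> k; apply/val_inj/eq_ij.
Qed.

End Unimodular.

(** * Straightening *)

(** By the pigeonhole principle r takes the same value at two elements x, y of X.
    The transposition of x and y fixes r, so composing c with it changes the sign
    of the pairing. *)
Lemma pairing_garnir m n (r : {ffun 'I_(m * n) -> 'I_m})
    (c : {ffun 'I_(m * n) -> 'I_n}) (X : {set 'I_(m * n)}) :
  (m < #|X|)%N -> \sum_(s | perm_on X s) pairing r (precomp c s) = 0.
Proof.
move=> lt_mX; have: ~~ dinjectiveb r X.
  apply: contraL lt_mX => /dinjectiveP r_inj.
  by rewrite -leqNgt -[leqRHS]card_ord (leq_card_in r).
case/dinjectivePn=> x Xx [y /andP[neq_yx Xy] rxy].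
set S := \sum_(s | _) _; pose t := tperm x y.
have onXt : perm_on X t.
  apply/subsetP=> z; rewrite inE /= /t; case: tpermP => [->|->|] //.
  by rewrite eqxx.
have onX_t s : perm_on X (t * s)%g = perm_on X s.
  apply/idP/idP=> onXs; last exact: perm_onM.
  by rewrite -(mulKg t s) tpermV perm_onM.
have: S = - S.
  rewrite /S -sumrN (reindex_inj (mulgI t)) /=; apply: eq_big => // s _.
  have ->: precomp c (t * s)%g = precomp (precomp c s) t.
    by apply/ffunP=> k; rewrite !ffunE permM.
  have {1}->: r = precomp r t.
    by apply/ffunP=> k; rewrite !ffunE /t; case: tpermP => // ->.
  by rewrite pairing_precomp odd_tperm eq_sym neq_yx mulN1r.
lia.
Qed.

Section Straightening.

Variables m n : nat.
Implicit Types (c : {ffun 'I_(m * n) -> 'I_n}) (X : {set 'I_(m * n)}).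
Variable h : {ffun 'I_(m * n) -> 'I_n} -> int.

Hypothesis h_garnir : forall c X, (m < #|X|)%N ->
  \sum_(s | perm_on X s) h (precomp c s) = 0.
Hypothesis h_standard : forall a : 'M['I_(m * n)]_(m, n),
  standard a -> h (col_of a) = 0.

(** The terms with c o s = c contribute a positive multiple of h c, since the
    identity is one of them; integers have no torsion. *)
Lemma garnir_vanish c X : (m < #|X|)%N ->
    (forall s, perm_on X s -> precomp c s != c -> h (precomp c s) = 0) ->
  h c = 0.
Proof.
move=> lt_mX h0; have := h_garnir c lt_mX.
rewrite (bigID (fun s => precomp c s == c)) /= [X in _ + X]big1 ?addr0; last first.
  by move=> s /andP[]; apply: h0.
under eq_bigr => s /andP[_ /eqP->] do [].
rewrite sumr_const => /eqP; rewrite mulrn_eq0 => /orP[|/eqP//].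
move/eqP/card0_eq/(_ 1%g); rewrite unfold_in perm_on1 /= => /eqP[].
by apply/ffunP=> k; rewrite ffunE perm1.
Qed.

(** The potential that straightening increases. *)
Definition weight c : nat := (\sum_(k < m * n) k * c k)%N.

Lemma weight_bound c : (weight c <= \sum_(k < m * n) k * n)%N.
Proof. by apply: leq_sum => k _; rewrite leq_mul2l (ltnW (ltn_ord _)) orbT. Qed.

(** On X the labelling c is decreasing: the larger label j2 sits on the entries up
    to p.  By the rearrangement inequality any other arrangement of these labels
    has larger weight. *)
Lemma weight_descent c X (j1 j2 : 'I_n) (p : nat) s :
    (j1 < j2)%N ->
    (forall x, x \in X -> c x = j2 /\ (x <= p)%N \/ c x = j1 /\ (p < x)%N) ->
    perm_on X s -> precomp c s != c ->
  (weight c < weight (precomp c s))%N.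
Proof.
move=> lt_j12 cX onXs neq_cs.
(* Comparing k with the half-integer threshold p + 1/2, rather than with p, makes
   every change of label count strictly. *)
have le_k (k : 'I_(m * n)) : ((2 * (k * c k) + (2 * p).+1 * c (s k))%N <=
    (2 * (k * c (s k)) + (2 * p).+1 * c k)%N ?= iff (c (s k) == c k))%N.
  have [Xk | notXk] := boolP (k \in X); last first.
    by rewrite (out_perm onXs notXk) eqxx; split; rewrite ?eqxx.
  have Xsk : s k \in X by rewrite perm_closed.
  rewrite -val_eqE; split; last apply/eqP/eqP; move: (cX k Xk) (cX _ Xsk).
  - by case=> -[-> ?] [] [-> _] //; nia.
  - by case=> -[-> ?] [] [-> _] //; nia.
  by move=> _ _ ->.
have eq_sum : (\sum_k c (s k) = \sum_k c k)%N.
  by rewrite [RHS](reindex_inj (@perm_inj _ s)).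
have /ltn_leqif := leqif_sum (P := predT) (fun k _ => le_k k).
rewrite big_split [X in (_ < X)%N]big_split /= -!big_distrr /=.
rewrite eq_sum ltn_add2r ltn_pmul2l //.
have ->: weight (precomp c s) = (\sum_(k < m * n) k * c (s k))%N.
  by apply: eq_bigr => k _; rewrite ffunE.
move=> ->; apply: contra neq_cs => /forall_inP eq_c.
by apply/eqP/ffunP=> k; rewrite ffunE; apply/eqP/eq_c.
Qed.

(** Induction on the weight, downwards.  If a fiber of c has more than m elements,
    the permutations of that fiber fix c and the Garnir relation gives h c = 0.
    Otherwise all fibers have m elements and, sorted, are the columns of a
    tableau T.  If T is not standard, then T i j2 < T i j1 for some j1 < j2, and
    the entries of column j1 from row i on together with those of column j2 up
    to row i form a set of m + 1 elements to which the relation applies. *)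
Lemma straightening c : h c = 0.
Proof.
pose W := (\sum_(k < m * n) k * n)%N.
have [w] := ubnP (W - weight c)%N; elim: w c => // w IHw c lt_w.
pose fiber j := [pred k | c k == j].
case: (pickP [pred j | (m < #|fiber j|)%N]) => [j /= lt_mj | le_fiber].
  apply: (@garnir_vanish c [set k in fiber j]) => [|s onXs]; first by rewrite cardsE.
  case/eqP; apply/ffunP=> k; rewrite ffunE; have := perm_closed k onXs.
  rewrite !inE; case: (boolP (k \in [set k in fiber j])) => [|notXk _].
      by rewrite inE => /eqP ck; rewrite ck eqxx => /eqP.
  by rewrite (out_perm onXs notXk).
have card_fiber j : #|fiber j| = m.
  have le_j i : (#|fiber i| <= m ?= iff (#|fiber i| == m))%N.
    by split=> //; rewrite leqNgt; apply: negbT (le_fiber i).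
  have [_] := leqif_sum (P := predT) (fun i _ => le_j i).
  have ->: (\sum_i #|fiber i| = \sum_(i < n) m)%N.
    transitivity #|'I_(m * n)|; last by rewrite sum_nat_const !card_ord mulnC.
    rewrite -sum1_card (partition_big c predT) //=.
    by apply: eq_bigr => i _; rewrite sum1_card.
  by rewrite eqxx => /esym/forall_inP/(_ j isT)/eqP.
pose T : 'M['I_(m * n)]_(m, n) := \matrix_(i, j) nth (box i j) (enum (fiber j)) i.
have size_fiber (i : 'I_m) j : (i < size (enum (fiber j)))%N.
  by rewrite -cardE card_fiber.
have cT i j : c (T i j) = j.
  apply/eqP; rewrite mxE.
  by have := mem_nth (box i j) (size_fiber i j); rewrite mem_enum.
have colT (i1 i2 : 'I_m) j : (i1 < i2)%N -> (T i1 j < T i2 j)%N.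
  move=> lt_i12; rewrite !mxE (set_nth_default (box i2 j)) //.
  apply: (sorted_ltn_nth (leT := fun k l : 'I_(m * n) => (k < l)%N)) => //.
  - by move=> l k p; apply: ltn_trans.
  - exact: sorted_enum_ord.
  - exact: size_fiber.
  exact: size_fiber.
have T_inj i1 i2 j1 j2 : T i1 j1 = T i2 j2 -> i1 = i2 /\ j1 = j2.
  move=> eqT; have eqj : j1 = j2 by rewrite -(cT i1 j1) eqT cT.
  split=> //; move: eqT; rewrite {j1}eqj => eqT; apply/val_inj.
  by case: (ltngtP i1 i2) => // /(colT _ _ j2); rewrite eqT ltnn.
have f_inj : injective (fun k => T (box_row k) (box_col k)).
  by move=> k l /T_inj[eq_r eq_c]; rewrite -(boxK k) -(boxK l) eq_r eq_c.
have tabT : tableau T.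
  have -> : T = map_mx (perm f_inj) (tab1 m n).
    by apply/matrixP=> i j; rewrite [RHS]mxE permE [tab1 m n i j]mxE box_rowK box_colK.
  exact: tableau_map.
have def_c : c = col_of T.
  by apply/ffunP=> k; rewrite -{1}(entryK tabT k) cT.
case: (boolP (rows_increase T)) => [rowT | ].
  rewrite def_c; apply: h_standard; rewrite /standard tabT rowT /=.
  apply/forallP=> j; apply/forallP=> i1; apply/forallP=> i2; apply/implyP.
  exact: colT.
case/forallPn=> i /forallPn[j1 /forallPn[j2]]; rewrite negb_imply => /andP[lt_j12].
rewrite -leqNgt leq_eqVlt => /orP[/eqP/val_inj/T_inj[_ eq_j] | lt_T].
  by rewrite eq_j ltnn in lt_j12.
(* The m + 1 entries are indexed by option 'I_m: one per row, taken from column j2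
   above row i and from column j1 below, and both entries of row i, of which None
   stands for the one in column j2. *)
pose x (o : option 'I_m) :=
  if o is Some i' then T i' (if (i' < i)%N then j2 else j1) else T i j2.
have x_inj : injective x.
  case=> [i1|] [i2|] //= /T_inj[] // => [-> // | eq_i | <-].
    by rewrite eq_i ltnn => eq_j; rewrite eq_j ltnn in lt_j12.
  by rewrite ltnn => eq_j; rewrite eq_j ltnn in lt_j12.
pose X := [set x o | o : option 'I_m].
have lt_mX : (m < #|X|)%N by rewrite card_imset // card_option card_ord.
have cX k : k \in X -> c k = j2 /\ (k <= T i j2)%N \/ c k = j1 /\ (T i j2 < k)%N.
  case/imsetP=> -[i'|] _ ->; rewrite /x ?cT; last by left.
  case: ltnP => [lt_i | le_i]; [left | right]; split=> //; first exact/ltnW/colT.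
  apply: leq_trans lt_T _; move: le_i; rewrite leq_eqVlt.
  by case/orP=> [/eqP/val_inj-> // | /(colT _ _ j1)/ltnW].
apply: (garnir_vanish lt_mX) => s onXs neq_cs; apply: IHw.
have := weight_descent lt_j12 cX onXs neq_cs.
by have := weight_bound (precomp c s); rewrite -/W; lia.
Qed.

End Straightening.


(** * The expansion of the determinant *)

Lemma syt_trK N r c : cancel (@syt_tr N r c) (@syt_tr N c r).
Proof. by move=> a; apply/val_inj; rewrite /= trmxK. Qed.

Lemma Phi_inverse m n (a a' : syt (m * n) m n) :
  \sum_(d : syt (m * n) m n)
     signed_bracket a (syt_tr d) * Phi a' (syt_tr d) = (a == a')%:R.
Proof.
have /matrixP/(_ (enum_rank a) (enum_rank a')) := mulmxV (EFE_unit m n).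
rewrite !mxE (inj_eq enum_rank_inj) => <-.
rewrite [RHS](reindex _ (onW_bij _ (enum_rank_bij _))) /=.
by apply: eq_bigr => d _; rewrite /Phi !mxE !enum_rankK syt_trK.
Qed.

(** The difference of the two sides is, as a function of c, a combination of
    functions <r, c>, and vanishes at c = col_of a' with a' standard because
    there Phi inverts the signed pairing; straightening does the rest. *)
Lemma pairing_expand m n (r : {ffun 'I_(m * n) -> 'I_m})
    (c : {ffun 'I_(m * n) -> 'I_n}) :
  \sum_(a : syt (m * n) m n) \sum_(d : syt (m * n) m n)
     Phi a (syt_tr d) * (eps (val a) * pairing r (col_of (val a))) *
       (eps (val d) * pairing (row_of (val d)) c) =
  pairing r c.
Proof.
pose h (c' : {ffun 'I_(m * n) -> 'I_n}) : int :=
  \sum_(a : syt (m * n) m n) \sum_(d : syt (m * n) m n)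
     Phi a (syt_tr d) * (eps (val a) * pairing r (col_of (val a))) *
       (eps (val d) * pairing (row_of (val d)) c') - pairing r c'.
apply/eqP; rewrite -subr_eq0; apply/eqP; apply: (@straightening _ _ h).
  move=> {}c X lt_mX; rewrite sumrB pairing_garnir // subr0 exchange_big big1 //= => a _.
  rewrite exchange_big big1 //= => d _.
  by rewrite -!mulr_sumr pairing_garnir // !mulr0.
move=> a' std_a'; pose a0 : syt (m * n) m n := Sub a' std_a'.
have eps2 (a : syt (m * n) m n) : eps (val a) * eps (val a) = 1.
  exact/eps_sq/standard_tableau/valP.
suff row_a0 (a : syt (m * n) m n) :
    \sum_(d : syt (m * n) m n)
       Phi a (syt_tr d) * (eps (val a) * pairing r (col_of (val a))) *
         (eps (val d) * pairing (row_of (val d)) (col_of a')) =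
    (a0 == a)%:R * pairing r (col_of (val a)).
  rewrite /h (eq_bigr _ (fun a _ => row_a0 a)) (bigD1 a0) //= eqxx mul1r.
  by rewrite big1 ?addr0 ?subrr // => a; rewrite eq_sym => /negPf->; rewrite mul0r.
transitivity (\sum_(d : syt (m * n) m n)
    signed_bracket a0 (syt_tr d) * Phi a (syt_tr d) *
    (eps (val a0) * eps (val a) * pairing r (col_of (val a)))).
  apply: eq_bigr => d _; rewrite signed_bracketE.
  (* The square of eps a0 supplies the sign that the signed bracket carries. *)
  transitivity (eps (val a0) * eps (val a0) * (Phi a (syt_tr d) *
     (eps (val a) * pairing r (col_of (val a))) *
     (eps (val d) * pairing (row_of (val d)) (col_of a')))).
    by rewrite eps2 mul1r.
  rewrite [val a0]/=; ring.
rewrite -mulr_suml Phi_inverse; case: eqP => [<-|]; last by rewrite !mul0r.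
by rewrite eps2 !mul1r.
Qed.

Lemma minor_prod_col_expand (R : comPzRingType) m n (A : 'M[R]_(m * n, m))
    (a : 'M['I_(m * n)]_(m, n)) : standard a ->
  minor_prod A a = \sum_(r : {ffun 'I_(m * n) -> 'I_m})
    (\prod_k A k (r k)) * (eps a * pairing r (col_of a))%:~R.
Proof.
move=> std_a; rewrite minor_prod_col // det_amalgam_indr mulr_sumr.
by apply: eq_bigr => r _; rewrite mulrCA -intrM.
Qed.

Lemma minor_prod_row_expand (R : comPzRingType) m n (B : 'M[R]_(m * n, n))
    (d : 'M['I_(m * n)]_(m, n)) : standard d ->
  minor_prod B d^T = \sum_(c : {ffun 'I_(m * n) -> 'I_n})
    (\prod_k B k (c k)) * (eps d * pairing (row_of d) c)%:~R.
Proof.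
move=> std_d; rewrite minor_prod_row // det_amalgam_indl mulr_sumr.
by apply: eq_bigr => c _; rewrite mulrCA -intrM.
Qed.

Theorem theorem3p6 (m n : nat) (hm : (1 <= m)%N) (hn : (1 <= n)%N)
    (R : comPzRingType) (A : 'M[R]_(m * n, m)) (B : 'M[R]_(m * n, n)) :
  \det (amalgam A B) =
    \sum_(a : syt (m * n) m n) \sum_(b : syt (m * n) n m)
      (Phi a b)%:~R * minor_prod A (val a) * minor_prod B (val b).
Proof.
transitivity (\sum_(a : syt (m * n) m n) \sum_(d : syt (m * n) m n)
    \sum_(r : {ffun 'I_(m * n) -> 'I_m}) \sum_(c : {ffun 'I_(m * n) -> 'I_n})
    (\prod_k A k (r k)) * (\prod_k B k (c k)) *
      (Phi a (syt_tr d) * (eps (val a) * pairing r (col_of (val a))) *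
       (eps (val d) * pairing (row_of (val d)) c))%:~R).
  rewrite det_amalgam_expand.
  under [RHS]eq_bigr do rewrite exchange_big.
  rewrite [RHS]exchange_big; apply: eq_bigr => r _ /=.
  under [RHS]eq_bigr do rewrite exchange_big.
  rewrite [RHS]exchange_big; apply: eq_bigr => c _ /=.
  rewrite -pairing_expand rmorph_sum mulr_sumr; apply: eq_bigr => a _.
  by rewrite rmorph_sum mulr_sumr.
apply: eq_bigr => a _.
rewrite [RHS](reindex _ (onW_bij _ (Bijective (@syt_trK _ m n) (@syt_trK _ n m)))).
apply: eq_bigr => d _ /=.
rewrite (minor_prod_col_expand _ (valP a)) (minor_prod_row_expand _ (valP d)).
rewrite -mulrA big_distrlr mulr_sumr; apply: eq_bigr => r _.
rewrite [RHS]mulr_sumr; apply: eq_bigr => c _.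
by rewrite !intrM /=; ring.
Qed.
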